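(* Suppose $\boldsymbol{X}\in[q]^N$ is an observation from the Potts model $\mathbb{P}_{\beta,\boldsymbol{B}}$ with $\beta>0$, $\boldsymbol{B}\in\mathbb{R}^{q-1}$, where the coupling matrix $\boldsymbol{A}_N$ satisfies $$\sup_{N\ge1}\max_{i\in[N]}\sum_{j=1}^Na_{ij}<\infty,\qquad\liminf_{N\to\infty}\frac1N\sum_{1\le i,j\le N}a_{ij}>0,\qquad\lim_{N\to\infty}\frac1N\sum_{1\le i,j\le N}a_{ij}^2=0.$$ Let $\mathcal{S}_{N,q}$ be the set of all $\boldsymbol{y}=((y_{i,r}))_{i\in[N],r\in[q]}\in[0,1]^{Nq}$ with $\sum_{r=1}^qy_{i,r}=1$ for all $i\in[N]$. Define $h_N,I_N,\psi_N:\mathcal{S}_{N,q}\to\mathbb{R}$ by $$h_N(\boldsymbol{y})=\frac\beta2\sum_{1\le i,j\le N}\sum_{r=1}^qa_{ij}y_{i,r}y_{j,r}+\sum_{i=1}^N\sum_{r=1}^qB_ry_{i,r},\qquad I_N(\boldsymbol{y})=\sum_{i=1}^N\sum_{r=1}^qy_{i,r}\log y_{i,r},\qquad\psi_N=h_N-I_N.$$ Let $\boldsymbol\theta(\boldsymbol{X})=((\theta_{i,r}(\boldsymbol{X})))_{i\in[N],r\in[q]}$ be the array of conditional probabilities $\theta_{i,r}(\boldsymbol{X})=\mathbb{P}_{\beta,\boldsymbol{B}}(X_i=r\mid(X_j)_{j\ne i})$, let $\nabla_{\cdot r}(\boldsymbol{y}):=((\partial\psi_N/\partial y_{i,r}(\boldsymbol{y})))_{i\in[N]}\in\mathbb{R}^N$,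 and $\overline\nabla(\boldsymbol{y}):=\frac1q\sum_{r=1}^q\nabla_{\cdot r}(\boldsymbol{y})$. Then: (a) As $N\to\infty$, $\displaystyle\psi_N(\boldsymbol\theta(\boldsymbol{X}))=\sup_{\boldsymbol{y}\in\mathcal{S}_{N,q}}\psi_N(\boldsymbol{y})+o_{\mathbb{P}}(N)$. (b) For all $r\in[q]$, as $N\to\infty$, $\displaystyle\|\nabla_{\cdot r}(\boldsymbol\theta(\boldsymbol{X}))-\overline\nabla(\boldsymbol\theta(\boldsymbol{X}))\|=o_{\mathbb{P}}(\sqrt N)$ (Euclidean norm).
   Context: Fix an integer $q\ge2$; $[m]=\{1,\dots,m\}$; $0\log0:=0$. For each $N$, $\boldsymbol{A}_N=((a_{ij}))_{1\le i,j\le N}$ is a deterministic symmetric matrix with zero diagonal and non-negative entries. For $\beta>0$ and $\boldsymbol{B}=(B_1,\dots,B_{q-1})\in\mathbb{R}^{q-1}$, with the convention $B_q:=0$, the Potts model is the probability mass function on $[q]^N$ $$\mathbb{P}_{\beta,\boldsymbol{B}}(\boldsymbol{x})=\frac{1}{Z_N(\beta,\boldsymbol{B})}\exp\Big(\frac\beta2\sum_{1\le i,j\le N}a_{ij}\mathbf 1_{x_i=x_j}+\sum_{i=1}^N\sum_{r=1}^qB_r\mathbf 1_{x_i=r}\Big),$$ with $Z_N(\beta,\boldsymbol{B})$ the normalizing constant. With $m_{i,r}(\boldsymbol{x}):=\sum_{j=1}^Na_{ij}\mathbf 1_{x_j=r}$, $$\theta_{i,r}(\boldsymbol{X})=\frac{\exp\{\beta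 m_{i,r}(\boldsymbol{X})+B_r\}}{\sum_{s=1}^q\exp\{\beta m_{i,s}(\boldsymbol{X})+B_s\}}.$$ The partial derivatives of $\psi_N$ are those of its defining formula with all $Nq$ coordinates treated as free variables: $\frac{\partial\psi_N(\boldsymbol{y})}{\partial y_{i,r}}=\beta\sum_{j=1}^Na_{ij}y_{j,r}+B_r-1-\log y_{i,r}$. $o_{\mathbb{P}}$ is as $N\to\infty$ under $\mathbb{P}_{\beta,\boldsymbol{B}}$. *)

(* Defs.v *)
From HB Require Import structures.
From mathcomp Require Import all_boot all_order all_algebra.
From mathcomp Require Import all_classical all_reals all_analysis.
From mathcomp Require Import ring.
Import Order.TTheory GRing.Theory Num.Theory.
Import numFieldNormedType.Exports.

Set Implicit Arguments.
Unset Strict Implicit.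
Unset Printing Implicit Defensive.

Local Open Scope classical_set_scope.
Local Open Scope ring_scope.

(* The spins [q] are 'I_q and the field is B : 'rV_q.-1; the last spin, which
   has no coordinate in B, gets field 0 (the convention B_q := 0). *)
Definition ext_field (R : realType) (q : nat) (B : 'rV[R]_q.-1) (r : 'I_q) : R :=
  if insub (val r) is Some k then B ord0 k else 0.

Definition potts_weight (R : realType) (q N : nat) (A : 'M[R]_N)
    (beta : R) (B : 'rV[R]_q.-1) (x : {ffun 'I_N -> 'I_q}) : R :=
  expR (beta / 2 * (\sum_(i < N) \sum_(j < N) A i j * (x i == x j)%:R)
        + \sum_(i < N) \sum_(r < q) ext_field B r * (x i == r)%:R).

Definition potts_Z (R : realType) (q N : nat) (A : 'M[R]_N)
    (beta : R) (B : 'rV[R]_q.-1) : R :=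
  \sum_(x : {ffun 'I_N -> 'I_q}) potts_weight A beta B x.

Definition potts_pmf (R : realType) (q N : nat) (A : 'M[R]_N)
    (beta : R) (B : 'rV[R]_q.-1) (x : {ffun 'I_N -> 'I_q}) : R :=
  potts_weight A beta B x / potts_Z A beta B.

Definition potts_Pr (R : realType) (q N : nat) (A : 'M[R]_N)
    (beta : R) (B : 'rV[R]_q.-1) (E : pred {ffun 'I_N -> 'I_q}) : R :=
  \sum_(x | E x) potts_pmf A beta B x.

Definition agree_off (q N : nat) (i : 'I_N) (x : {ffun 'I_N -> 'I_q}) :
    pred {ffun 'I_N -> 'I_q} :=
  fun z => [forall j, (j != i) ==> (z j == x j)].

(* theta x i r = P(X_i = r | (X_j)_(j != i)), evaluated at the configuration x. *)
Definition theta (R : realType) (q N : nat) (A : 'M[R]_N)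
    (beta : R) (B : 'rV[R]_q.-1) (x : {ffun 'I_N -> 'I_q}) : 'M[R]_(N, q) :=
  \matrix_(i, r)
    (potts_Pr A beta B (fun z => (z i == r) && agree_off i x z)
     / potts_Pr A beta B (agree_off i x)).

Definition simplex_prod (R : realType) (N q : nat) : set 'M[R]_(N, q) :=
  [set y | (forall i r, 0 <= y i r <= 1) /\
           (forall i, \sum_(r < q) y i r = 1)].
Arguments simplex_prod : clear implicits.

Definition potts_h (R : realType) (q N : nat) (A : 'M[R]_N)
    (beta : R) (B : 'rV[R]_q.-1) (y : 'M[R]_(N, q)) : R :=
  beta / 2 * (\sum_(i < N) \sum_(j < N) \sum_(r < q) A i j * y i r * y j r)
  + \sum_(i < N) \sum_(r < q) ext_field B r * y i r.

Definition potts_I (R : realType) (q N : nat) (y : 'M[R]_(N, q)) : R :=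
  \sum_(i < N) \sum_(r < q) y i r * ln (y i r).

Definition potts_psi (R : realType) (q N : nat) (A : 'M[R]_N)
    (beta : R) (B : 'rV[R]_q.-1) (y : 'M[R]_(N, q)) : R :=
  potts_h A beta B y - potts_I y.

(* Partial derivatives of the formula for psi on the whole of 'M_(N, q): the
   N * q coordinates are free, not tied by the row-sum constraints. *)
Definition grad_psi (R : realType) (q N : nat) (A : 'M[R]_N)
    (beta : R) (B : 'rV[R]_q.-1) (r : 'I_q) (y : 'M[R]_(N, q)) : 'cV[R]_N :=
  \col_(i < N) 'D_(delta_mx i r) (potts_psi A beta B) y.

Definition mean_grad_psi (R : realType) (q N : nat) (A : 'M[R]_N)
    (beta : R) (B : 'rV[R]_q.-1) (y : 'M[R]_(N, q)) : 'cV[R]_N :=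
  q%:R^-1 *: \sum_(r < q) grad_psi A beta B r y.

(* The library norm `|v| on matrices is the sup norm. *)
Definition l2norm (R : realType) (n : nat) (v : 'cV[R]_n) : R :=
  Num.sqrt (\sum_(i < n) v i ord0 ^+ 2).

(* Y_N(X) = o_P(a_N) for X distributed as the Potts model on [q]^N. *)
Definition potts_oP (R : realType) (q : nat) (A : forall N, 'M[R]_N)
    (beta : R) (B : 'rV[R]_q.-1)
    (Y : forall N, {ffun 'I_N -> 'I_q} -> R) (a : nat -> R) : Prop :=
  forall eps : R, 0 < eps ->
    (fun N => potts_Pr (A N) beta B (fun x => eps * a N < `|Y N x|)) @ \oo
      --> (0 : R).

Definition respin (q N : nat) (i : 'I_N) (r : 'I_q) (x : {ffun 'I_N -> 'I_q}) :
    {ffun 'I_N -> 'I_q} :=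
  [ffun j => if j == i then r else x j].

Lemma agree_off_respin (q N : nat) (i : 'I_N) (r : 'I_q)
    (x z : {ffun 'I_N -> 'I_q}) :
  (z i == r) && agree_off i x z = (z == respin i r x).
Proof.
apply/andP/eqP => [[/eqP zi /forallP zx]|->].
  apply/ffunP => j; rewrite ffunE; case: eqVneq => [->//|ji].
  by have /implyP/(_ ji)/eqP := zx j.
split; first by rewrite ffunE eqxx.
by apply/forallP => j; apply/implyP => ji; rewrite ffunE (negPf ji).
Qed.

Lemma potts_weight_respin (R : realType) (q N : nat) (A : 'M[R]_N)
    (beta : R) (B : 'rV[R]_q.-1) (x : {ffun 'I_N -> 'I_q}) (i : 'I_N) :
  A^T = A -> (forall i, A i i = 0) ->
  exists2 c : R, 0 < c & forall r : 'I_q,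
    potts_weight A beta B (respin i r x)
    = c * expR (beta * (\sum_(j < N) A i j * (x j == r)%:R) + ext_field B r).
Proof.
move=> Asym A0.
have Aji j : A j i = A i j by rewrite -[in LHS]Asym mxE.
exists (expR (beta / 2 * (\sum_(k < N | k != i) \sum_(l < N | l != i)
                            A k l * (x k == x l)%:R)
   + \sum_(k < N | k != i) \sum_(s < q) ext_field B s * (x k == s)%:R)).
  exact: expR_gt0.
move=> r; rewrite /potts_weight -expRD; congr expR.
have E1 : \sum_(k < N) \sum_(l < N)
      A k l * (respin i r x k == respin i r x l)%:R =
    2 * (\sum_(j < N) A i j * (x j == r)%:R)
    + \sum_(k < N | k != i) \sum_(l < N | l != i) A k l * (x k == x l)%:R.
  have Eoff : \sum_(l < N | l != i) A i l * (r == x l)%:R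
              = \sum_(j < N) A i j * (x j == r)%:R.
    rewrite [RHS](bigD1 i)//= A0 mul0r add0r.
    by apply: eq_bigr => l _; rewrite eq_sym.
  rewrite (bigD1 i)//= (bigD1 i)//= A0 mul0r add0r.
  rewrite (eq_bigr (fun l => A i l * (r == x l)%:R)); last first.
    by move=> l li; rewrite !ffunE eqxx (negPf li).
  rewrite Eoff.
  rewrite [X in _ + X](eq_bigr (fun k => A i k * (r == x k)%:R +
     \sum_(l < N | l != i) A k l * (x k == x l)%:R)); last first.
    move=> k ki; rewrite (bigD1 i)//= !ffunE eqxx (negPf ki) Aji eq_sym.
    congr (_ + _); apply: eq_bigr => l li.
    by rewrite !ffunE (negPf li).
  by rewrite big_split/= Eoff; ring.
have E2 : \sum_(k < N) \sum_(s < q) ext_field B s * (respin i r x k == s)%:R =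
    ext_field B r
    + \sum_(k < N | k != i) \sum_(s < q) ext_field B s * (x k == s)%:R.
  rewrite (bigD1 i)//=; congr (_ + _).
    rewrite ffunE eqxx (bigD1 r)//= eqxx mulr1 big1 ?addr0// => s sr.
    by rewrite eq_sym (negPf sr) mulr0.
  by apply: eq_bigr => k ki; apply: eq_bigr => s _; rewrite ffunE (negPf ki).
by rewrite E1 E2; field.
Qed.

(* The conditional probabilities theta in closed form. *)
Lemma thetaE (R : realType) (q N : nat) (A : 'M[R]_N)
    (beta : R) (B : 'rV[R]_q.-1) (x : {ffun 'I_N -> 'I_q}) (i : 'I_N) (r : 'I_q) :
  A^T = A -> (forall i, A i i = 0) ->
  let m s := \sum_(j < N) A i j * (x j == s)%:R in
  theta A beta B x i r =
  expR (beta * m r + ext_field B r)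
  / \sum_(s < q) expR (beta * m s + ext_field B s).
Proof.
move=> Asym A0 m; rewrite mxE.
have [c c0 wE] := potts_weight_respin beta B x i Asym A0.
have Z0 : potts_Z A beta B != 0.
  rewrite gt_eqF// /potts_Z (bigD1 x)//= ltr_pwDl ?expR_gt0//.
  by apply: sumr_ge0 => z _; exact: expR_ge0.
have PE s : potts_Pr A beta B (fun z => (z i == s) && agree_off i x z) =
    c / potts_Z A beta B * expR (beta * m s + ext_field B s).
  rewrite /potts_Pr (eq_bigl (pred1 (respin i s x))); last first.
    by move=> z; rewrite agree_off_respin.
  by rewrite big_pred1_eq /potts_pmf wE mulrAC.
have -> : potts_Pr A beta B (agree_off i x) =
    c / potts_Z A beta B * \sum_(s < q) expR (beta * m s + ext_field B s).
  rewrite /potts_Pr (partition_big (fun z : {ffun _ -> _} => z i) predT)//= mulr_sumr.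
  apply: eq_bigr => s _; rewrite -PE; apply: eq_bigl => z; exact: andbC.
rewrite PE -mulf_div divff ?mul1r//.
by rewrite mulf_neq0 ?invr_eq0// gt_eqF.
Qed.

Lemma is_derive_sumf (R : realType) (n : nat) (f : 'I_n -> R -> R) (x : R)
    (df : 'I_n -> R) : (forall i, is_derive x 1 (f i) (df i)) ->
  is_derive x 1 (fun t => \sum_(i < n) f i t) (\sum_(i < n) df i).
Proof.
move=> h; have -> : (fun t => \sum_(i < n) f i t) = \sum_(i < n) f i.
  by apply/funext => t; rewrite fct_sumE.
exact: is_derive_sum.
Qed.

Lemma sum_delta (R : realType) (N q : nat) (i : 'I_N) (r : 'I_q)
    (F : 'I_N -> 'I_q -> R) :
  \sum_(k < N) \sum_(s < q) ((k == i) && (s == r))%:R * F k s = F i r.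
Proof.
rewrite (bigD1 i)//= [X in _ + X]big1 ?addr0; last first.
  by move=> k ki; apply: big1 => s _; rewrite (negPf ki) mul0r.
rewrite (bigD1 r)//= big1 ?addr0; first by rewrite !eqxx mul1r.
by move=> s sr; rewrite (negPf sr) andbF mul0r.
Qed.

(* theta has positive entries, so this closed form of the gradient applies to
   it; at a zero coordinate the partial derivative does not exist. *)
Lemma grad_psiE (R : realType) (q N : nat) (A : 'M[R]_N)
    (beta : R) (B : 'rV[R]_q.-1) (y : 'M[R]_(N, q)) (i : 'I_N) (r : 'I_q) :
  A^T = A -> 0 < y i r ->
  grad_psi A beta B r y i ord0 =
  beta * (\sum_(j < N) A i j * y j r) + ext_field B r - 1 - ln (y i r).
Proof.
move=> Asym y0; rewrite mxE.
pose d (k : 'I_N) (s : 'I_q) : R := ((k == i) && (s == r))%:R.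
pose e k s (t : R) : R := t * d k s + y k s.
pose f (t : R) : R :=
  (beta / 2 * (\sum_(k < N) \sum_(l < N) \sum_(s < q) A k l * (e k s t * e l s t))
  + \sum_(k < N) \sum_(s < q) ext_field B s * e k s t)
  - (\sum_(k < N) \sum_(s < q) e k s t * ln (e k s t)).
have fE t : potts_psi A beta B (t *: delta_mx i r + y) = f t.
  rewrite /potts_psi /potts_h /potts_I /f; congr (_ * _ + _ - _).
  - apply: eq_bigr => k _; apply: eq_bigr => l _; apply: eq_bigr => s _.
    by rewrite !mxE -/(d k s) -/(d l s) mulrA.
  - by apply: eq_bigr => k _; apply: eq_bigr => s _; rewrite !mxE.
  - by apply: eq_bigr => k _; apply: eq_bigr => s _; rewrite !mxE.
have -> : 'D_(delta_mx i r) (potts_psi A beta B) y = 'D_1 f 0.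
  rewrite /derive; set g := (fun _ : R => _); set g' := (fun _ : R => _).
  suff -> : g = g' by [].
  apply/funext => h; rewrite /g /g' /=.
  by rewrite fE [h%:A]mulr1 addr0 -(fE 0) scale0r add0r.
have de k s : is_derive (0 : R) 1 (e k s) (d k s).
  have -> : e k s = (d k s \*: (@id R)) + cst (y k s).
    by apply/funext => t; rewrite /e /= mulrC.
  have h := is_deriveD (is_deriveZ (d k s) (is_derive_id (0 : R) (1 : R)))
                       (is_derive_cst (y k s) (0 : R) (1 : R)).
  apply: (is_derive_eq h).
  by rewrite addr0 [_ *: _]mulr1.
have e0 k s : e k s 0 = y k s by rewrite /e mul0r add0r.
have dq k l s : is_derive (0 : R) 1 (fun t => A k l * (e k s t * e l s t))
    (A k l * (d k s * y l s + y k s * d l s)).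
  have -> : (fun t => A k l * (e k s t * e l s t)) = A k l \*: (e k s * e l s).
    by [].
  have h := is_deriveZ (A k l) (is_deriveM (de k s) (de l s)).
  apply: (is_derive_eq h).
  rewrite !e0 /GRing.scale/=; ring.
have db k s : is_derive (0 : R) 1 (fun t => ext_field B s * e k s t)
    (ext_field B s * d k s).
  have -> : (fun t => ext_field B s * e k s t) = ext_field B s \*: e k s by [].
  exact: (is_deriveZ (ext_field B s) (de k s)).
have dl k s : is_derive (0 : R) 1 (fun t => e k s t * ln (e k s t))
    (d k s * (1 + ln (y k s))).
  have [/andP[/eqP-> /eqP->]|nks] := boolP ((k == i) && (s == r)).
    have dln : is_derive (0 : R) 1 (@ln R \o e i r) ((y i r)^-1 * d i r).
      apply: (is_derive1_comp _ (de i r)); rewrite e0.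
      exact: is_derive1_ln.
    have -> : (fun t => e i r t * ln (e i r t)) = e i r * (@ln R \o e i r) by [].
    have h := is_deriveM (de i r) dln.
    apply: (is_derive_eq h); rewrite /= !e0 /GRing.scale/=.
    by field; rewrite gt_eqF.
  rewrite /d (negPf nks) mul0r.
  have -> : (fun t => e k s t * ln (e k s t)) = cst (y k s * ln (y k s)).
    by apply/funext => t; rewrite /e /d (negPf nks) mulr0 add0r.
  exact: is_derive_cst.
have dQ := is_derive_sumf (fun k => is_derive_sumf (fun l => is_derive_sumf (dq k l))).
have dB := is_derive_sumf (fun k => is_derive_sumf (db k)).
have dL := is_derive_sumf (fun k => is_derive_sumf (dl k)).
have -> := @derive_val _ _ _ _ _ _ _
   (is_deriveB (is_deriveD (is_deriveZ (beta / 2) dQ) dB) dL).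
have -> : \sum_(k < N) \sum_(s < q) ext_field B s * d k s = ext_field B r.
  rewrite -[RHS](sum_delta i r (fun _ s => ext_field B s)).
  by apply: eq_bigr => k _; apply: eq_bigr => s _; rewrite mulrC.
rewrite (sum_delta i r (fun k s => 1 + ln (y k s))).
have -> : \sum_(k < N) \sum_(l < N) \sum_(s < q)
     A k l * (d k s * y l s + y k s * d l s) =
   2 * \sum_(j < N) A i j * y j r.
  have H : \sum_(k < N) \sum_(l < N) \sum_(s < q) A k l * (d k s * y l s) =
           \sum_(j < N) A i j * y j r.
    rewrite exchange_big/=; apply: eq_bigr => l _.
    rewrite -[RHS](sum_delta i r (fun k s => A k l * y l s)).
    by apply: eq_bigr => k _; apply: eq_bigr => s _; rewrite mulrCA.
  have H' : \sum_(k < N) \sum_(l < N) \sum_(s < q) A k l * (y k s * d l s) =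
           \sum_(j < N) A i j * y j r.
    rewrite -H exchange_big/=; apply: eq_bigr => k _; apply: eq_bigr => l _.
    apply: eq_bigr => s _.
    by rewrite -[in LHS]Asym mxE [y l s * _]mulrC.
  rewrite [2 * _]mulr_natl mulr2n -{1}H -H' -big_split/=; apply: eq_bigr => k _.
  rewrite -big_split/=; apply: eq_bigr => l _.
  by rewrite -big_split/=; apply: eq_bigr => s _; rewrite mulrDr.
by rewrite /GRing.scale/=; field.
Qed.

(* Main.v *)
(** Write m(y) = A y, and e = 1_X - theta(X), so that m(e) is the error made when
    the local fields of X are replaced by those of theta(X).

    Since e_j has conditional mean zero given the other spins, and theta_k moves
    by O(a_jk) when X_j is changed, E |m(e)|^2 = O(sum a_ij^2) = o(N). The
    centered gradient of psi at theta is -beta times the centered m(e), which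
    gives (b).

    For (a), the Gibbs variational principle gives sup psi <= log Z, so by Markov
    it is enough that log Z <= E psi(theta(X)) + o(N). Now
    log Z = E h(1_X) - E log P(X), and E h(1_X) = E h(theta) + o(N) by the bound
    on m(e). To bound the entropy, compare P with the law that reveals a random
    set of sites of density t uniformly and draws every other site from the
    softmax of the local field estimated on the revealed set, rescaled by 1/t.
    The estimate has variance at most sum_j a_ij^2 / t, so the cross entropy is
    at most t N log q - E sum_i log theta_{i, X_i} + o(N), and
    E sum_i log theta_{i, X_i} = E I(theta). *)
Require Import Defs.
From HB Require Import structures.
From mathcomp Require Import all_boot all_order all_algebra.
From mathcomp Require Import all_classical all_reals all_analysis.
From mathcomp Require Import ring lra.
Import Order.TTheory GRing.Theory Num.Theory.
Import numFieldNormedType.Exports.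

Local Open Scope classical_set_scope.
Local Open Scope ring_scope.

Set Implicit Arguments.
Unset Strict Implicit.
Unset Printing Implicit Defensive.

(** * Elementary inequalities *)

(** AM-GM with a free scale [d]: first-order errors are traded for second moments, the only
    quantities estimated below. *)
Lemma norm_le_add_sqr {R : realType} (u d : R) : 0 < d -> `|u| <= d + d^-1 * u ^+ 2.
Proof.
move=> d0; rewrite -(ler_pM2l d0) mulrDr mulVKf ?gt_eqF//.
rewrite -[u ^+ 2]real_normK ?num_real//.
have := sqr_ge0 (`|u| - d); have := normr_ge0 u; nra.
Qed.

(** One term of a sum of squared deviations, and centering at the mean does not increase the sum of
    squares. *)
Lemma sqr_center_le {R : realType} {q : nat} (f : 'I_q -> R) (r : 'I_q) :
  (f r - q%:R^-1 * \sum_s f s) ^+ 2 <= \sum_s f s ^+ 2.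
Proof.
set m := q%:R^-1 * _.
have q0 : q%:R != 0 :> R by rewrite pnatr_eq0 -lt0n; case: r => r; case: (q).
apply: (@le_trans _ _ (\sum_s (f s - m) ^+ 2)).
  by rewrite [leRHS](bigD1 r)//= lerDl sumr_ge0// => s _; rewrite sqr_ge0.
rewrite -subr_ge0 -sumrB.
rewrite (eq_bigr (fun s => 2 * m * f s - m ^+ 2)); last by move=> s _; ring.
rewrite sumrB -mulr_sumr sumr_const card_ord -(mulr_natr (m ^+ 2)).
have -> : \sum_s f s = m * q%:R by rewrite /m mulrAC mulVf// mul1r.
rewrite [leRHS](_ : _ = m ^+ 2 * q%:R); first by rewrite mulr_ge0 ?sqr_ge0.
by ring.
Qed.

Lemma ln_le_sub1 {R : realType} (x : R) : 0 < x -> ln x <= x - 1.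
Proof.
move=> x0; have := @le_ln1Dx R (x - 1).
by rewrite [1 + _]addrC addrNK ltrDr => ->.
Qed.

(** * Averages against finite weights, Markov and Gibbs inequalities *)

Definition wmean {R : realType} {T : finType} (p f : T -> R) : R :=
  \sum_x p x * f x.

Section WeightedMean.
Context {R : realType} {T : finType} (p : T -> R).

Lemma wmeanD f g : wmean p (fun x => f x + g x) = wmean p f + wmean p g.
Proof. by rewrite /wmean -big_split; apply: eq_bigr => x _; rewrite mulrDr. Qed.

Lemma wmeanN f : wmean p (fun x => - f x) = - wmean p f.
Proof. by rewrite /wmean -sumrN; apply: eq_bigr => x _; rewrite mulrN. Qed.

Lemma wmeanB f g : wmean p (fun x => f x - g x) = wmean p f - wmean p g.
Proof. by rewrite wmeanD wmeanN. Qed.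

Lemma wmeanZ c f : wmean p (fun x => c * f x) = c * wmean p f.
Proof. by rewrite /wmean mulr_sumr; apply: eq_bigr => x _; rewrite mulrCA. Qed.

Lemma wmean_sum (I : Type) (r : seq I) (P : pred I) (f : I -> T -> R) :
  wmean p (fun x => \sum_(i <- r | P i) f i x)
  = \sum_(i <- r | P i) wmean p (f i).
Proof. by rewrite /wmean exchange_big; apply: eq_bigr => x _; rewrite mulr_sumr. Qed.

Lemma eq_wmean f g : f =1 g -> wmean p f = wmean p g.
Proof. by move=> fg; apply: eq_bigr => x _; rewrite fg. Qed.

Hypothesis p0 : forall x, 0 <= p x.

Lemma ler_wmean f g : (forall x, f x <= g x) -> wmean p f <= wmean p g.
Proof. by move=> fg; apply: ler_sum => x _; exact: ler_wpM2l. Qed.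

Hypothesis p1 : \sum_x p x = 1.

Lemma wmean_cst c : wmean p (fun=> c) = c.
Proof. by rewrite /wmean -mulr_suml p1 mul1r. Qed.

Lemma wmean_le_cst f c : (forall x, f x <= c) -> wmean p f <= c.
Proof. by move=> fc; rewrite -[leRHS]wmean_cst ler_wmean. Qed.

Lemma markov_wmean f a : 0 < a -> (forall x, 0 <= f x) ->
  \sum_(x | a < f x) p x <= a^-1 * wmean p f.
Proof.
move=> a0 f0; rewrite /wmean mulr_sumr [leRHS](bigID (fun x => a < f x))/=.
rewrite -[leLHS]addr0 lerD//; last first.
  by apply: sumr_ge0 => x _; rewrite !mulr_ge0// invr_ge0 ltW.
apply: ler_sum => x /ltW afx; rewrite mulrCA ler_peMr// ler_pdivlMl//.
by rewrite mulr1.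
Qed.

(** Non-negativity of relative entropy, from [ln x <= x - 1]. Total mass at most one is enough for
    [g], which suits the revealed law below. *)
Lemma gibbs_inequality g : (forall x, 0 < g x) -> \sum_x g x <= 1 ->
  wmean p (fun x => ln (g x)) <= wmean p (fun x => ln (p x)).
Proof.
move=> g0 g1; rewrite -subr_le0 -wmeanB.
apply: (@le_trans _ _ (\sum_x (g x - p x))); last by rewrite sumrB p1 subr_le0.
apply: ler_sum => x _.
have [px|px] := eqVneq (p x) 0; first by rewrite px mul0r subr0 ltW.
have {}px : 0 < p x by rewrite lt_neqAle eq_sym px p0.
rewrite -ln_div ?posrE//.
apply: (@le_trans _ _ (p x * (g x / p x - 1))).
  by rewrite ler_pM2l// ln_le_sub1 ?divr_gt0.
by rewrite mulrBr mulr1 mulrCA divff ?mulr1// gt_eqF.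
Qed.

End WeightedMean.

(** * Product measures *)

Definition prodw {R : realType} {I T : finType} (y : I -> T -> R)
  (x : {ffun I -> T}) : R := \prod_i y i (x i).

Section ProductMeasure.
Context {R : realType} {I T : finType} (y : I -> T -> R).
Hypothesis y1 : forall i, \sum_t y i t = 1.

Lemma wmean_prodw_prod (g : I -> T -> R) :
  wmean (prodw y) (fun x => \prod_i g i (x i)) = \prod_i wmean (y i) (g i).
Proof.
rewrite /wmean bigA_distr_bigA; apply: eq_bigr => x _.
by rewrite /prodw -big_split.
Qed.

Lemma sum_prodw : \sum_x prodw y x = 1.
Proof. by rewrite -(bigA_distr_bigA y) big1. Qed.

Lemma wmean_prodw1 i (g : T -> R) :
  wmean (prodw y) (fun x => g (x i)) = wmean (y i) g.
Proof.
pose G j t := if j == i then g t else 1.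
rewrite -(@eq_wmean _ _ _ (fun x : {ffun I -> T} => \prod_j G j (x j))); last first.
  by move=> x; rewrite (bigD1 i)//= big1 /G ?eqxx ?mulr1// => j /negPf->.
rewrite wmean_prodw_prod (bigD1 i)//= big1 ?mulr1.
  by apply: eq_wmean => t; rewrite /G eqxx.
by move=> j ji; rewrite /G (negPf ji) wmean_cst.
Qed.

Lemma wmean_prodw2 i j (g h : T -> R) : i != j ->
  wmean (prodw y) (fun x => g (x i) * h (x j)) = wmean (y i) g * wmean (y j) h.
Proof.
move=> ij; have ji : j != i by rewrite eq_sym.
pose G k t := if k == i then g t else if k == j then h t else 1.
rewrite -(@eq_wmean _ _ _ (fun x : {ffun I -> T} => \prod_k G k (x k))); last first.
  move=> x; rewrite (bigD1 i)//= (bigD1 j)//= big1 /G ?eqxx ?mulr1 ?(negPf ji)//.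
  by move=> k /andP[/negPf-> /negPf->].
rewrite wmean_prodw_prod (bigD1 i)//= (bigD1 j)//= big1 ?mulr1.
  by congr (_ * _); apply: eq_wmean => t; rewrite /G ?(negPf ji) eqxx.
by move=> k /andP[/negPf ki /negPf kj]; rewrite /G ki kj wmean_cst.
Qed.

(** Variance of a sum of independent centered terms: the cross terms factor and vanish. *)
Lemma wmean_prodw_sqr (g : I -> T -> R) : (forall i, wmean (y i) (g i) = 0) ->
  wmean (prodw y) (fun x => (\sum_i g i (x i)) ^+ 2)
  = \sum_i wmean (y i) (fun t => g i t ^+ 2).
Proof.
move=> g0.
rewrite (@eq_wmean _ _ _ _
  (fun x : {ffun I -> T} => \sum_i \sum_j g i (x i) * g j (x j))).
  rewrite wmean_sum; apply: eq_bigr => i _; rewrite wmean_sum (bigD1 i)//=.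
  rewrite (wmean_prodw1 i (fun t => g i t * g i t)) big1 ?addr0//.
  by move=> j ji; rewrite (wmean_prodw2 (g i) (g j)) 1?eq_sym// g0 mul0r.
move=> x; rewrite expr2 mulr_suml; apply: eq_bigr => i _.
by rewrite mulr_sumr.
Qed.

Hypothesis y0 : forall i t, 0 <= y i t.

Lemma prodw_ge0 x : 0 <= prodw y x.
Proof. by apply: prodr_ge0. Qed.

Lemma wmean_ln_prodw :
  wmean (prodw y) (fun x => ln (prodw y x))
  = \sum_i wmean (y i) (fun t => ln (y i t)).
Proof.
rewrite [RHS](eq_bigr _ (fun i _ =>
  esym (wmean_prodw1 i (fun t => ln (y i t))))) -wmean_sum.
apply: eq_bigr => x _.
(* The logarithm of the product splits only when all factors are positive; otherwise the weight
   itself is zero. *)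
have [/existsP[i /eqP yi]|/existsPn ypos] := boolP [exists i, y i (x i) == 0].
  by rewrite /prodw (bigD1 i)//= yi !mul0r.
have {}ypos i : 0 < y i (x i) by rewrite lt_neqAle eq_sym ypos y0.
congr (_ * _); rewrite /prodw.
have [] // : 0 < \prod_i y i (x i) /\
    ln (\prod_i y i (x i)) = \sum_i ln (y i (x i)).
apply: (big_rec2 (fun a b => 0 < a /\ ln a = b)); first by rewrite ln1.
by move=> i a b _ [a0 <-]; rewrite mulr_gt0// lnM ?posrE.
Qed.

End ProductMeasure.

(** * A law built from a set of revealed coordinates *)

(** Hidden coordinates get the filler [t0], so a partial configuration keeps the type of a full
    one. *)
Definition reveal {I T : finType} (t0 : T) (S : {ffun I -> bool})
  (x : {ffun I -> T}) : {ffun I -> T} :=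
  [ffun i => if S i then x i else t0].

(* The law of: draw the revealed coordinates uniformly, then the others
   independently with laws [k w i] depending on the revealed configuration [w]. *)
Lemma revealed_law_mass {R : realType} {I T : finType} (t0 : T)
    (S : {ffun I -> bool}) (k : {ffun I -> T} -> I -> T -> R) :
  (forall w i t, 0 <= k w i t) -> (forall w i, \sum_t k w i t = 1) ->
  \sum_(x : {ffun I -> T})
     \prod_i (if S i then #|T|%:R^-1 else k (reveal t0 S x) i (x i)) <= 1.
Proof.
move=> k0 k1.
have T0 : #|T|%:R != 0 :> R.
  by rewrite pnatr_eq0 -lt0n; apply/card_gt0P; exists t0.
(* Joint weight of a revealed configuration [w] and a full one [x]: revealed sites of [w] are
   uniform and copied by [x], hidden sites of [w] hold [t0] and [x] follows [k w]. Given [x], the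
   choice [w = reveal t0 S x] recovers the wanted product; summing over all [w] allows integrating
   out [x] first. *)
pose K (w : {ffun I -> T}) i t : R :=
  if S i then #|T|%:R^-1 * (t == w i)%:R else (w i == t0)%:R * k w i t.
have K0 w i t : 0 <= K w i t by rewrite /K; case: ifP => _; rewrite mulr_ge0.
apply: (@le_trans _ _ (\sum_(x : {ffun I -> T}) \sum_(w : {ffun I -> T})
  \prod_i K w i (x i))).
  apply: ler_sum => x _; rewrite (bigD1 (reveal t0 S x))//=.
  rewrite -[leLHS]addr0 lerD ?sumr_ge0//; last by move=> w _; apply: prodr_ge0.
  rewrite le_eqVlt; apply/orP; left; apply/eqP/eq_bigr => i _.
  by rewrite /K !ffunE; case: ifP => _; rewrite eqxx ?mulr1 ?mul1r.
rewrite exchange_big/=.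
have KE (w : {ffun I -> T}) : \sum_(x : {ffun I -> T}) \prod_i K w i (x i) =
    \prod_i (if S i then #|T|%:R^-1 else (w i == t0)%:R).
  rewrite -(bigA_distr_bigA (K w)); apply: eq_bigr => i _; rewrite /K.
  case: (S i); last by rewrite -mulr_sumr k1 mulr1.
  by rewrite -mulr_sumr (bigD1 (w i))//= eqxx big1 ?addr0 ?mulr1// => t /negPf->.
rewrite (eq_bigr _ (fun w _ => KE w)).
rewrite -(bigA_distr_bigA (fun i (u : T) => if S i then #|T|%:R^-1 else (u == t0)%:R)).
rewrite big1// => i _; case: (S i).
  by rewrite sumr_const -(mulr_natr (_^-1)) mulVf.
by rewrite (bigD1 t0)//= eqxx big1 ?addr0// => t /negPf->.
Qed.

(** * The softmax function *)

Definition softmax {R : realType} {q : nat} (v : 'I_q -> R) (r : 'I_q) : R :=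
  expR (v r) / \sum_s expR (v s).

Section Softmax.
Context {R : realType} {q : nat}.
Implicit Types (u v : 'I_q -> R) (r : 'I_q).

Lemma sum_expR_gt0 v r : 0 < \sum_s expR (v s).
Proof.
rewrite (bigD1 r)//= ltr_pwDl ?expR_gt0//.
by apply: sumr_ge0 => s _; exact: expR_ge0.
Qed.

Lemma softmax_gt0 v r : 0 < softmax v r.
Proof. by rewrite divr_gt0 ?expR_gt0// (sum_expR_gt0 _ r). Qed.

Lemma softmax_sum1 v r : \sum_s softmax v s = 1.
Proof. by rewrite -mulr_suml divff// gt_eqF// (sum_expR_gt0 _ r). Qed.

Lemma softmax_le1 v r : softmax v r <= 1.
Proof.
rewrite -(softmax_sum1 v r) (bigD1 r)//= lerDl sumr_ge0// => s _.
exact/ltW/softmax_gt0.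
Qed.

Lemma ln_softmax v r : ln (softmax v r) = v r - ln (\sum_s expR (v s)).
Proof. by rewrite ln_div ?posrE ?expR_gt0 ?(sum_expR_gt0 _ r)// expRK. Qed.

(** With [d] the total distance, [u s <= d + v s] for each [s], so the sums of exponentials differ
    by a factor at most [expR d]. *)
Lemma ln_sum_expR_lipschitz u v r :
  ln (\sum_s expR (u s)) - ln (\sum_s expR (v s)) <= \sum_s `|u s - v s|.
Proof.
set d := (X in _ <= X).
rewrite lerBlDr -[d]expRK -lnM ?posrE ?expR_gt0 ?(sum_expR_gt0 _ r)//.
rewrite ler_ln ?posrE ?mulr_gt0 ?expR_gt0 ?(sum_expR_gt0 _ r)//.
rewrite mulr_sumr; apply: ler_sum => s _; rewrite -expRD ler_expR -lerBlDr.
rewrite (le_trans (ler_norm _))// /d (bigD1 s)//= lerDl sumr_ge0//.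
Qed.

Lemma ln_softmax_lipschitz u v r :
  ln (softmax u r) - ln (softmax v r) <= 2 * \sum_s `|u s - v s|.
Proof.
rewrite !ln_softmax.
have h := ln_sum_expR_lipschitz v u r.
have -> : 2 * \sum_s `|u s - v s| =
    \sum_s `|u s - v s| + \sum_s `|v s - u s|.
  rewrite mulr_natl mulr2n; congr (_ + _).
  by apply: eq_bigr => s _; rewrite distrC.
have h2 : u r - v r <= \sum_s `|u s - v s|.
  rewrite (le_trans (ler_norm _))// (bigD1 r)//= lerDl sumr_ge0//.
lra.
Qed.

Lemma softmax_lipschitz u v r :
  `|softmax u r - softmax v r| <= 2 * \sum_s `|u s - v s|.
Proof.
wlog uv : u v / softmax v r <= softmax u r.
  move=> W; have [/W//|/ltW/W] := leP (softmax v r) (softmax u r).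
  by rewrite distrC; under eq_bigr do rewrite distrC.
rewrite ger0_norm ?subr_ge0//.
apply: le_trans (ln_softmax_lipschitz u v r).
set a := softmax u r in uv *; set b := softmax v r in uv *.
have a0 : 0 < a := softmax_gt0 u r.
have b0 : 0 < b := softmax_gt0 v r.
have a1 : a <= 1 := softmax_le1 u r.
(* For [b <= a <= 1] one has [a - b <= 1 - b / a <= ln a - ln b], so the Lipschitz bound on the
   logarithm transfers. *)
have h := ln_le_sub1 (divr_gt0 b0 a0).
rewrite ln_div ?posrE// in h.
apply: (@le_trans _ _ (1 - b / a)); last lra.
rewrite -[X in X - b / a](mulfV (lt0r_neq0 a0)) -mulrBl ler_pdivlMr//.
by rewrite ler_piMr// subr_ge0.
Qed.

End Softmax.

(** * The Potts measure at fixed N *)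

(** Configurations as vertices of the product simplex, where [potts_h] is the Hamiltonian. *)
Definition onehot {R : realType} {N q : nat} (x : {ffun 'I_N -> 'I_q}) :
  'M[R]_(N, q) := \matrix_(i, r) (x i == r)%:R.

Lemma sum_onehot {R : realType} {N q : nat} (x : {ffun 'I_N -> 'I_q}) i
  (f : 'I_q -> R) : \sum_r onehot x i r * f r = f (x i).
Proof.
rewrite (bigD1 (x i))//= mxE eqxx mul1r big1 ?addr0// => r /negPf ri.
by rewrite mxE eq_sym ri mul0r.
Qed.

(* The fibres of [respin i r0] are the sets of configurations differing only
   at [i]; each is parametrized by the spin at [i]. *)
Lemma sum_respin_eq0 {R : realType} {N q : nat} (hq : (0 < q)%N) (i : 'I_N)
  (F : {ffun 'I_N -> 'I_q} -> R) :
  (forall x, \sum_s F (respin i s x) = 0) -> \sum_x F x = 0.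
Proof.
move=> F0; pose r0 := Ordinal hq.
rewrite (partition_big (respin i r0) predT)//= big1// => w _.
have [wi|wi] := eqVneq (w i) r0; last first.
  rewrite big1// => x /eqP xw; case/eqP: wi; rewrite -xw ffunE eqxx//.
rewrite (partition_big (fun x : {ffun 'I_N -> 'I_q} => x i) predT)//=.
rewrite -[RHS](F0 w); apply: eq_bigr => s _.
rewrite (eq_bigl (pred1 (respin i s w))) ?big_pred1_eq// => x /=.
apply/andP/eqP => [[/eqP <- /eqP <-]|->].
  by apply/ffunP => j; rewrite !ffunE; case: eqP => [->|].
split; last by rewrite ffunE eqxx.
by apply/eqP/ffunP => j; rewrite !ffunE; case: eqP => [->|].
Qed.

Section Potts.
Context {R : realType} {q N : nat} (A : 'M[R]_N) (beta : R) (B : 'rV[R]_q.-1).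
Hypotheses (hq : (0 < q)%N) (Asym : A^T = A) (Adiag : forall i, A i i = 0).
Hypotheses (Age0 : forall i j, 0 <= A i j) (beta0 : 0 < beta).

Local Notation config := {ffun 'I_N -> 'I_q}.
Local Notation mu := (potts_pmf A beta B).
Local Notation th := (theta A beta B).
Local Notation b := (ext_field B).
Implicit Types (x : config) (i j k : 'I_N) (r s : 'I_q).

Let A_sym i j : A i j = A j i.
Proof. by rewrite -[in LHS]Asym mxE. Qed.

Lemma potts_hE (y : 'M[R]_(N, q)) :
  potts_h A beta B y
  = \sum_i \sum_r y i r * (beta / 2 * (A *m y) i r + b r).
Proof.
rewrite /potts_h mulr_sumr -big_split; apply: eq_bigr => i _ /=.
rewrite exchange_big/= mulr_sumr -big_split; apply: eq_bigr => r _ /=.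
rewrite mulrDr [b r * _]mulrC; congr (_ + _); rewrite mxE.
rewrite mulrCA; congr (_ * _); rewrite mulr_sumr; apply: eq_bigr => j _.
by rewrite mulrCA mulrA.
Qed.

Lemma potts_weightE x : potts_weight A beta B x = expR (potts_h A beta B (onehot x)).
Proof.
rewrite /potts_weight /potts_h; congr expR; congr (_ + _); first congr (_ * _).
  apply: eq_bigr => i _; apply: eq_bigr => j _.
  rewrite (eq_bigr (fun r => onehot x i r * (A i j * onehot x j r))); last first.
    by move=> r _; ring.
  by rewrite (sum_onehot x i (fun r => A i j * onehot x j r)) mxE eq_sym.
by apply: eq_bigr => i _; apply: eq_bigr => r _; rewrite mxE.
Qed.

Lemma potts_Z_gt0 : 0 < potts_Z A beta B.
Proof.
rewrite /potts_Z (bigD1 [ffun=> Ordinal hq])//= ltr_pwDl ?expR_gt0//.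
by apply: sumr_ge0 => z _; exact: expR_ge0.
Qed.

Lemma potts_pmf_gt0 x : 0 < mu x.
Proof. by rewrite divr_gt0 ?potts_Z_gt0// expR_gt0. Qed.

Lemma potts_pmf_ge0 x : 0 <= mu x.
Proof. exact/ltW/potts_pmf_gt0. Qed.

Lemma sum_potts_pmf : \sum_x mu x = 1.
Proof. by rewrite -mulr_suml divff// gt_eqF// potts_Z_gt0. Qed.

Lemma ln_potts_pmf x :
  ln (mu x) = potts_h A beta B (onehot x) - ln (potts_Z A beta B).
Proof.
by rewrite ln_div ?posrE ?potts_Z_gt0 ?expR_gt0// potts_weightE expRK.
Qed.

Lemma thetaE_softmax x i r :
  th x i r = softmax (fun s => beta * (A *m onehot x) i s + b s) r.
Proof.
rewrite thetaE// /softmax.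
have E s : (A *m onehot x) i s = \sum_(j < N) A i j * (x j == s)%:R.
  by rewrite mxE; apply: eq_bigr => j _; rewrite mxE.
by rewrite -E; congr (_ / _); apply: eq_bigr => s _; rewrite -E.
Qed.

Lemma theta_gt0 x i r : 0 < th x i r.
Proof. by rewrite thetaE_softmax softmax_gt0. Qed.

Lemma theta_le1 x i r : th x i r <= 1.
Proof. by rewrite thetaE_softmax softmax_le1. Qed.

Lemma onehot_theta_norm x i r : `|onehot x i r - th x i r| <= 1.
Proof.
have := theta_gt0 x i r; have := theta_le1 x i r; rewrite [onehot _ _ _]mxE.
by case: (_ == _) => /= h1 h2; rewrite ler_norml; apply/andP; split; clear -h1 h2; lra.
Qed.

Lemma sum_theta x i : \sum_r th x i r = 1.
Proof.
by under eq_bigr do rewrite thetaE_softmax; rewrite (softmax_sum1 _ (Ordinal hq)).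
Qed.

Lemma theta_simplex x : simplex_prod R N q (th x).
Proof.
split=> [i r|i]; last exact: sum_theta.
by rewrite theta_le1 ltW// theta_gt0.
Qed.

(** * Effect of changing one spin *)

Lemma mulmx_onehot_respin k j s x r :
  (A *m onehot (respin j s x)) k r
  = (A *m onehot x) k r + A k j * ((s == r)%:R - (x j == r)%:R).
Proof.
rewrite !mxE (bigD1 j)//= [in RHS](bigD1 j)//= !mxE ffunE eqxx.
rewrite (eq_bigr (fun l => A k l * onehot x l r)).
  by ring.
by move=> l lj; rewrite !mxE ffunE (negPf lj).
Qed.

Lemma mulmx_onehot_respin_id i s x r :
  (A *m onehot (respin i s x)) i r = (A *m onehot x) i r.
Proof. by rewrite mulmx_onehot_respin Adiag mul0r addr0. Qed.

Lemma theta_respin_id i s x r : th (respin i s x) i r = th x i r.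
Proof.
rewrite !thetaE_softmax; congr (softmax _ r); apply/funext => s'.
by rewrite mulmx_onehot_respin_id.
Qed.

Lemma theta_respin_dist k j s x r :
  `|th x k r - th (respin j s x) k r| <= 2 * beta * q%:R * A k j.
Proof.
rewrite !thetaE_softmax (le_trans (softmax_lipschitz _ _ _))//.
rewrite -!mulrA ler_pM2l//.
have -> : beta * (q%:R * A k j) = \sum_(s < q) beta * A k j.
  by rewrite sumr_const card_ord -(mulr_natr (beta * _)); ring.
apply: ler_sum => s' _; rewrite mulmx_onehot_respin.
set a := (A *m _) _ _; set d := _%:R - _%:R.
have -> : beta * a + b s' - (beta * (a + A k j * d) + b s')
   = - (beta * A k j * d) by ring.
have ba0 : 0 <= beta * A k j by rewrite mulr_ge0 ?(ltW beta0).
rewrite normrN normrM (ger0_norm ba0) ler_piMr//.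
by rewrite /d; case: (_ == _); case: (_ == _);
  rewrite ?subrr ?subr0 ?sub0r ?normrN ?normr0 ?normr1.
Qed.

(** Tower property: [theta] at site [i] is the conditional mean of the indicator given the other
    spins, and [g] ignores the spin at [i]. On each fibre of configurations differing only at [i]
    the difference sums to zero. *)
Lemma wmean_onehot_theta i r (g : config -> R) :
  (forall s x, g (respin i s x) = g x) ->
  wmean mu (fun x => onehot x i r * g x) = wmean mu (fun x => th x i r * g x).
Proof.
move=> gi; apply/eqP; rewrite -subr_eq0 -wmeanB; apply/eqP.
apply: (sum_respin_eq0 hq (i := i)) => x.
have [c c0 wE] := potts_weight_respin beta B x i Asym Adiag.
pose m s := beta * (A *m onehot x) i s + b s.
have muE s : mu (respin i s x) = c / potts_Z A beta B * expR (m s).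
  rewrite /potts_pmf wE mulrAC /m mxE.
  congr (_ * _); congr expR; congr (_ + _); congr (_ * _).
  by apply: eq_bigr => j _; rewrite mxE.
rewrite (eq_bigr (fun s => c / potts_Z A beta B * g x *
    ((s == r)%:R * expR (m s) - th x i r * expR (m s)))); last first.
  by move=> s _; rewrite gi theta_respin_id muE mxE ffunE eqxx; ring.
rewrite -mulr_sumr sumrB -mulr_sumr (bigD1 r)//= eqxx mul1r big1 ?addr0.
  by rewrite thetaE_softmax divfK ?subrr ?mulr0// gt_eqF// (sum_expR_gt0 _ r).
by move=> s /negPf->; rewrite mul0r.
Qed.

(** * Second moment of the local field error *)

Local Notation F := (\sum_i \sum_j A i j ^+ 2).

(** Freezing spin [j] inside [theta] at [k] makes the second factor independent of that spin, hence
    orthogonal to the first. The freezing costs a multiple of [A k j]. *)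
Lemma wmean_cross_le j k r : j != k ->
  wmean mu (fun x => (onehot x j r - th x j r) * (onehot x k r - th x k r))
  <= 2 * beta * q%:R * A k j.
Proof.
move=> jk; pose g x := onehot x k r - th (respin j (Ordinal hq) x) k r.
have gj s x : g (respin j s x) = g x.
  rewrite /g; congr (_ - _); first by rewrite !mxE ffunE (eq_sym k) (negPf jk).
  suff -> : respin j (Ordinal hq) (respin j s x) = respin j (Ordinal hq) x by [].
  by apply/ffunP => l; rewrite !ffunE; case: eqP.
have g0 : wmean mu (fun x => (onehot x j r - th x j r) * g x) = 0.
  under eq_wmean do rewrite mulrBl.
  by rewrite wmeanB wmean_onehot_theta// subrr.
rewrite -[leLHS]subr0 -[X in _ - X]g0 -wmeanB.
apply: (wmean_le_cst potts_pmf_ge0 sum_potts_pmf) => x.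
rewrite -mulrBr /g.
rewrite [X in _ * X](_ : _ = th (respin j (Ordinal hq) x) k r - th x k r); last first.
  by rewrite opprB addrCA addrAC subrr add0r.
apply: le_trans (ler_norm _) _; rewrite normrM.
rewrite -[leRHS]mul1r.
apply: ler_pM => //; first exact: onehot_theta_norm.
by rewrite distrC theta_respin_dist.
Qed.

(** Expanding the square, diagonal terms give [F], and off-diagonal ones a sum over triangles
    [A i j * A i k * A j k], bounded by [M * F]. *)
Lemma wmean_field_error_le M : (forall i, \sum_j A i j <= M) ->
  wmean mu (fun x => \sum_i \sum_r (A *m (onehot x - th x)) i r ^+ 2)
  <= q%:R * (1 + 2 * beta * q%:R * M) * F.
Proof.
move=> AM; pose C := 2 * beta * q%:R.
have C0 : 0 <= C by rewrite !mulr_ge0 ?(ltW beta0).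
rewrite wmean_sum; under eq_bigr do rewrite wmean_sum.
rewrite exchange_big/= -mulrA [leRHS]mulr_natl -[X in _ *+ X]card_ord -sumr_const.
apply: ler_sum => r _.
pose e x j := onehot x j r - th x j r.
have sqE i : wmean mu (fun x => (A *m (onehot x - th x)) i r ^+ 2) =
    \sum_j \sum_k A i j * A i k * wmean mu (fun x => e x j * e x k).
  under eq_bigr => j _ do under eq_bigr => k _ do rewrite -wmeanZ.
  under eq_bigr => j _ do rewrite -wmean_sum.
  rewrite -wmean_sum; apply: eq_wmean => x; rewrite mxE expr2 mulr_suml.
  apply: eq_bigr => j _; rewrite mulr_sumr; apply: eq_bigr => k _.
  by rewrite !mxE /e !mxE; ring.
under eq_bigr do rewrite sqE.
apply: (@le_trans _ _ (\sum_i \sum_j (A i j ^+ 2 +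
    \sum_k A i j * A i k * (C * A j k)))).
  apply: ler_sum => i _; apply: ler_sum => j _.
  rewrite (bigD1 j)//= lerD//.
    rewrite -expr2 ler_piMr ?sqr_ge0//.
    apply: (wmean_le_cst potts_pmf_ge0 sum_potts_pmf) => x.
    by rewrite -expr2 -real_normK ?num_real// expr_le1// onehot_theta_norm.
  (* The term [k = j] is put back in the upper bound, being non-negative, so that the sum runs over
     all [k]. *)
  rewrite [leRHS](bigD1 j)//= -[leLHS]add0r.
  apply: lerD; first by apply: mulr_ge0; apply: mulr_ge0.
  apply: ler_sum => k kj; apply: ler_wpM2l; first exact: mulr_ge0.
  by rewrite (A_sym j); apply: wmean_cross_le; rewrite eq_sym.
have -> : \sum_i \sum_j (A i j ^+ 2 + \sum_k A i j * A i k * (C * A j k)) =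
    F + \sum_i \sum_j \sum_k A i j * A i k * (C * A j k).
  by rewrite -big_split; apply: eq_bigr => i _; rewrite -big_split.
rewrite mulrDl mul1r lerD2l.
(* [2 a_ij a_ik a_jk <= a_ij^2 a_jk + a_ik^2 a_jk], and the row sums are at most M *)
have T1 : \sum_i \sum_j \sum_k A i j ^+ 2 * A j k <= M * F.
  rewrite mulr_sumr; apply: ler_sum => i _; rewrite mulr_sumr.
  apply: ler_sum => j _; rewrite -mulr_sumr mulrC ler_wpM2r// sqr_ge0//.
have T2 : \sum_i \sum_j \sum_k A i k ^+ 2 * A j k <= M * F.
  apply: le_trans T1; rewrite le_eqVlt; apply/orP; left; apply/eqP.
  apply: eq_bigr => i _; rewrite exchange_big; apply: eq_bigr => j _.
  by apply: eq_bigr => k _; rewrite (A_sym j k).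
rewrite -mulrA; apply: (@le_trans _ _ (C / 2 *
  (\sum_i \sum_j \sum_k A i j ^+ 2 * A j k +
   \sum_i \sum_j \sum_k A i k ^+ 2 * A j k))); last first.
  rewrite -mulrA ler_wpM2l// mulrC ler_pdivrMr//; lra.
rewrite -big_split mulr_sumr; apply: ler_sum => i _ /=.
rewrite -big_split mulr_sumr; apply: ler_sum => j _ /=.
rewrite -big_split mulr_sumr; apply: ler_sum => k _ /=.
rewrite mulrCA -[leRHS]mulrA ler_wpM2l// -mulrDl mulrA ler_wpM2r//.
have := sqr_ge0 (A i j - A i k); nra.
Qed.

(** * Lower and upper bounds on the log-partition function *)

(** The zero diagonal leaves only products of spins at distinct sites, which are independent. *)
Lemma wmean_onehot (y : 'M[R]_(N, q)) : simplex_prod R N q y ->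
  wmean (prodw y) (fun x => potts_h A beta B (onehot x)) = potts_h A beta B y.
Proof.
move=> [y0 y1]; rewrite /potts_h wmeanD wmeanZ.
have dE i r : wmean (y i) (fun t => (t == r)%:R) = y i r.
  rewrite /wmean (bigD1 r)//= eqxx mulr1 big1 ?addr0// => t /negPf->.
  by rewrite mulr0.
congr (_ + _); first congr (_ * _).
  rewrite wmean_sum; apply: eq_bigr => i _.
  rewrite wmean_sum; apply: eq_bigr => j _.
  rewrite wmean_sum; apply: eq_bigr => r _.
  have [->|ij] := eqVneq i j.
    rewrite Adiag !mul0r -[RHS](wmean_cst (sum_prodw y1)).
    by apply: eq_wmean => x; rewrite !mul0r.
  rewrite -mulrA -[y i r]dE -[y j r]dE -(wmean_prodw2 y1 _ _ ij) -wmeanZ.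
  by apply: eq_wmean => x; rewrite !mxE mulrA.
rewrite wmean_sum; apply: eq_bigr => i _.
rewrite wmean_sum; apply: eq_bigr => r _.
rewrite -[y i r]dE -(wmean_prodw1 y1) -wmeanZ.
by apply: eq_wmean => x; rewrite !mxE.
Qed.

(** Gibbs inequality for the product measure with marginals [y] against the Potts measure. *)
Lemma potts_psi_le_ln_Z (y : 'M[R]_(N, q)) : simplex_prod R N q y ->
  potts_psi A beta B y <= ln (potts_Z A beta B).
Proof.
move=> ys; have [y01 y1] := ys.
have y0 i r : 0 <= y i r by have /andP[] := y01 i r.
have mu_le1 : \sum_x mu x <= 1 by rewrite sum_potts_pmf.
have := gibbs_inequality (prodw_ge0 y0) (sum_prodw y1)
  potts_pmf_gt0 mu_le1.
rewrite (wmean_ln_prodw y1 y0).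
under eq_wmean do rewrite ln_potts_pmf//.
rewrite wmeanB (wmean_cst (sum_prodw y1)) wmean_onehot//.
by rewrite lerBlDr -lerBlDl.
Qed.

(* Fluctuation of the estimate of the local field by the density-[t] sample [c]. *)
Let sampling_error (t : R) (c : {ffun 'I_N -> bool}) x i s : R :=
  \sum_j A i j * onehot x j s * (t^-1 * (c j)%:R - 1).

(** Gibbs inequality for the Potts measure against the revealed law for a fixed set [c]. A revealed
    site costs [ln q]; a hidden one costs minus the log of its conditional probability plus a
    Lipschitz error in the estimated field. *)
Lemma ln_potts_Z_le_sample (t d : R) (c : {ffun 'I_N -> bool}) :
  0 < d ->
  ln (potts_Z A beta B) <= wmean mu (fun x =>
    potts_h A beta B (onehot x) - \sum_i ln (th x i (x i))
    + \sum_i (c i)%:R * ln q%:R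
    + 2 * beta * \sum_i \sum_s (d + d^-1 * sampling_error t c x i s ^+ 2)).
Proof.
move=> d0; pose r0 := Ordinal hq.
pose k (w : config) i r := softmax (fun s =>
  beta * (t^-1 * \sum_j A i j * ((c j)%:R * onehot w j s)) + b s) r.
pose g x := \prod_i (if c i then #|'I_q|%:R^-1 else k (reveal r0 c x) i (x i)).
have q0 : 0 < q%:R :> R by rewrite ltr0n.
have g0 x : 0 < g x.
  apply: prodr_gt0 => i _; case: (c i); last exact: softmax_gt0.
  by rewrite card_ord invr_gt0.
have g1 : \sum_x g x <= 1.
  apply: revealed_law_mass => [w i r|w i]; first exact/ltW/softmax_gt0.
  exact: (softmax_sum1 _ r0).
(* The estimated field reads revealed sites only, so the filler spins do not matter. *)
have kE x i r : k (reveal r0 c x) i r = k x i r.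
  congr (softmax _ r); apply/funext => s; congr (_ * (_ * _) + _).
  apply: eq_bigr => j _; rewrite !mxE ffunE.
  by case: (c j); rewrite ?mul0r.
have := gibbs_inequality potts_pmf_ge0 sum_potts_pmf g0 g1.
under [X in _ <= X]eq_wmean do rewrite ln_potts_pmf//.
rewrite [X in _ <= X]wmeanB (wmean_cst sum_potts_pmf).
rewrite lerBrDl -lerBrDr -wmeanB => /le_trans; apply.
apply: (ler_wmean potts_pmf_ge0) => x.
rewrite -!addrA lerD2l.
have lng : ln (g x) = \sum_i (if c i then - ln q%:R else ln (k x i (x i))).
  have [] // : 0 < g x /\ ln (g x) =
      \sum_i (if c i then - ln q%:R else ln (k x i (x i))).
  rewrite /g; apply: (big_rec2 (fun a b => 0 < a /\ ln a = b)); first by rewrite ln1.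
  move=> i a a' _ [a0 <-]; case: (c i); rewrite ?card_ord.
    by rewrite mulr_gt0 ?invr_gt0// lnM ?posrE ?invr_gt0// lnV ?posrE.
  by rewrite kE mulr_gt0 ?softmax_gt0// lnM ?posrE ?softmax_gt0.
rewrite lng mulr_sumr -!sumrN -!big_split/=; apply: ler_sum => i _.
have S0 : 0 <= 2 * beta * \sum_s (d + d^-1 * sampling_error t c x i s ^+ 2).
  apply: mulr_ge0; first by rewrite mulr_ge0 ?(ltW beta0).
  apply: sumr_ge0 => s _; apply: addr_ge0; first exact: ltW.
  by rewrite mulr_ge0 ?sqr_ge0// invr_ge0 ltW.
case: (c i).
  have : ln (th x i (x i)) <= 0 by rewrite ln_le0// theta_le1.
  by rewrite mul1r; lra.
rewrite mul0r add0r.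
suff : ln (th x i (x i)) - ln (k x i (x i)) <=
    2 * beta * \sum_s (d + d^-1 * sampling_error t c x i s ^+ 2) by lra.
rewrite thetaE_softmax//; apply: le_trans (ln_softmax_lipschitz _ _ _) _.
rewrite -mulrA ler_pM2l// mulr_sumr; apply: ler_sum => s _.
rewrite [X in `|X|](_ : _ = - (beta * sampling_error t c x i s)).
  by rewrite normrN normrM gtr0_norm// ler_pM2l// norm_le_add_sqr.
rewrite opprD addrACA subrr addr0 -mulrBr -[RHS]mulrN; congr (_ * _).
rewrite mxE mulr_sumr -sumrB -sumrN; apply: eq_bigr => j _.
by ring.
Qed.

(** Averaging the preceding bound over [c] with independent Bernoulli([t]) entries. *)
Lemma ln_potts_Z_le (t d : R) : 0 < t -> t <= 1 -> 0 < d ->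
  ln (potts_Z A beta B) <=
  wmean mu (fun x => potts_h A beta B (onehot x) - \sum_i ln (th x i (x i)))
  + N%:R * t * ln q%:R
  + 2 * beta * (q%:R * (N%:R * d + d^-1 * t^-1 * F)).
Proof.
move=> t0 t1 d0.
pose y (_ : 'I_N) (e : bool) := if e then t else 1 - t.
have yE (f : bool -> R) i : wmean (y i) f = t * f true + (1 - t) * f false.
  by rewrite /wmean big_bool.
have y1 i : \sum_e y i e = 1 by rewrite big_bool/= addrC subrK.
have y0 i e : 0 <= y i e by case: e; rewrite ?subr_ge0 ?(ltW t0).
rewrite -[leLHS](wmean_cst (sum_prodw y1)).
apply: le_trans (ler_wmean (prodw_ge0 y0) (fun c => ln_potts_Z_le_sample t c d0)) _.
rewrite [leLHS](_ : _ = wmean mu (fun x => wmean (prodw y) (fun c =>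
    potts_h A beta B (onehot x) - \sum_i ln (th x i (x i))
    + \sum_i (c i)%:R * ln q%:R
    + 2 * beta * \sum_i \sum_s (d + d^-1 * sampling_error t c x i s ^+ 2)))); last first.
  rewrite {1 3}/wmean; under eq_bigr do rewrite /wmean mulr_sumr.
  rewrite exchange_big; apply: eq_bigr => x _; rewrite /wmean mulr_sumr.
  by apply: eq_bigr => c _; rewrite mulrCA.
rewrite -addrA -[X in _ <= _ + X](wmean_cst sum_potts_pmf) -wmeanD.
apply: (ler_wmean potts_pmf_ge0) => x.
rewrite wmeanD wmeanD (wmean_cst (sum_prodw y1)) -addrA lerD2l.
apply: lerD.
  rewrite wmean_sum (eq_bigr (fun=> t * ln q%:R)); last first.
    move=> i _; rewrite (wmean_prodw1 y1 i (fun e : bool => e%:R * ln q%:R)) yE.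
    by rewrite mul1r mul0r mulr0 addr0.
  by rewrite sumr_const card_ord -(mulr_natl (_ * _)) mulrA.
rewrite wmeanZ ler_wpM2l ?mulr_ge0 ?(ltW beta0)// wmean_sum.
have errE i s : wmean (prodw y) (fun c => d + d^-1 * sampling_error t c x i s ^+ 2)
    <= d + d^-1 * t^-1 * \sum_j A i j ^+ 2.
  rewrite wmeanD wmeanZ (wmean_cst (sum_prodw y1)) lerD2l -mulrA.
  rewrite ler_pM2l ?invr_gt0//.
  (* The rescaling by [t^-1] makes each summand centered; its variance is at most
     [(t^-1 - 1) * A i j ^+ 2]. *)
  rewrite (wmean_prodw_sqr y1 (g := fun j (e : bool) =>
     A i j * onehot x j s * (t^-1 * e%:R - 1))); last first.
    by move=> j; rewrite yE /=; field; rewrite gt_eqF.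
  rewrite mulr_sumr; apply: ler_sum => j _; rewrite yE mxE /=.
  case: (_ == _) => /=; last first.
    by rewrite !mulr0 !mul0r expr0n !mulr0 addr0 mulr_ge0 ?sqr_ge0 ?invr_ge0 ?(ltW t0).
  rewrite [leLHS](_ : _ = (t^-1 - 1) * A i j ^+ 2); last by field; rewrite gt_eqF.
  by rewrite ler_wpM2r ?sqr_ge0// lerBlDr lerDl.
apply: (@le_trans _ _ (\sum_i \sum_(s < q) (d + d^-1 * t^-1 * \sum_j A i j ^+ 2))).
  by apply: ler_sum => i _; rewrite wmean_sum; apply: ler_sum => s _.
rewrite exchange_big/= sumr_const card_ord -(mulr_natl (\sum_i _)).
by rewrite big_split/= sumr_const card_ord -(mulr_natl d) -mulr_sumr.
Qed.

(** * Comparison of entropy and energy at the conditional probabilities *)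

Lemma wmean_entropy :
  wmean mu (fun x => \sum_i ln (th x i (x i))) = wmean mu (fun x => potts_I (th x)).
Proof.
rewrite /potts_I !wmean_sum; apply: eq_bigr => i _; rewrite wmean_sum.
under eq_wmean => x do rewrite -(sum_onehot x i (fun r => ln (th x i r))).
rewrite wmean_sum; apply: eq_bigr => r _.
rewrite wmean_onehot_theta// => s x.
by rewrite theta_respin_id.
Qed.

(** The field at [i] does not see the spin at [i], so the first indicator in the quadratic form may
    be replaced by [theta] exactly. Replacing the second costs the field error. *)
Lemma wmean_energy_le (d : R) : 0 < d ->
  wmean mu (fun x => potts_h A beta B (onehot x))
  <= wmean mu (fun x => potts_h A beta B (th x)) + beta / 2 * (q%:R * N%:R * d
  + d^-1 * wmean mu (fun x => \sum_i \sum_r (A *m (onehot x - th x)) i r ^+ 2)).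
Proof.
move=> d0.
have -> : wmean mu (fun x => potts_h A beta B (onehot x)) =
    wmean mu (fun x => \sum_i \sum_r
      th x i r * (beta / 2 * (A *m onehot x) i r + b r)).
  under eq_wmean do rewrite potts_hE.
  rewrite !wmean_sum; apply: eq_bigr => i _.
  rewrite !wmean_sum; apply: eq_bigr => r _.
  by rewrite wmean_onehot_theta// => s x; rewrite mulmx_onehot_respin_id.
rewrite -wmeanZ -[q%:R * _ * d](wmean_cst sum_potts_pmf) -wmeanD -wmeanZ -wmeanD.
apply: (ler_wmean potts_pmf_ge0) => x.
rewrite potts_hE -lerBlDl -sumrB.
rewrite [leRHS](_ : _ = \sum_i \sum_r
    beta / 2 * (d + d^-1 * (A *m (onehot x - th x)) i r ^+ 2)); last first.
  under [RHS]eq_bigr do rewrite -mulr_sumr big_split/= -mulr_sumr sumr_const card_ord.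
  rewrite -mulr_sumr big_split/= -mulr_sumr sumr_const card_ord.
  by rewrite -(mulr_natl (_ *+ _)) -(mulr_natl d) mulrA [N%:R * _]mulrC.
apply: ler_sum => i _; rewrite -sumrB; apply: ler_sum => r _.
have b20 : 0 < beta / 2 by rewrite divr_gt0.
rewrite [leLHS](_ : _ = beta / 2 * (th x i r * (A *m (onehot x - th x)) i r)).
  rewrite ler_pM2l//; apply: le_trans (ler_norm _) _.
  apply: le_trans (norm_le_add_sqr _ d0); rewrite normrM ler_piMl//.
  by rewrite ger0_norm ?theta_le1// ltW// theta_gt0.
have -> : (A *m (onehot x - th x)) i r = (A *m onehot x) i r - (A *m th x) i r.
  by rewrite mulmxBr mxE [X in _ + X]mxE.
by ring.
Qed.

(* The choice [t = d] and [F <= N d^3] balances all error terms. *)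
Lemma wmean_psi_gap_le (M d : R) : (forall i, \sum_j A i j <= M) -> 0 <= M ->
  0 < d -> d <= 1 -> F <= N%:R * d ^+ 3 ->
  ln (potts_Z A beta B) - wmean mu (fun x => potts_psi A beta B (th x))
  <= N%:R * d * (beta / 2 * (q%:R + q%:R * (1 + 2 * beta * q%:R * M))
                 + ln q%:R + 4 * beta * q%:R).
Proof.
move=> AM M0 d0 d1 Fd.
have Z := ln_potts_Z_le d0 d1 d0.
rewrite wmeanB wmean_entropy in Z.
have H := wmean_energy_le d0.
have D := wmean_field_error_le AM.
rewrite /potts_psi wmeanB.
set D0 := wmean mu (fun x => \sum_i \sum_r _) in H D.
set C := q%:R * (1 + _) in D *.
have C0 : 0 <= C by rewrite /C !(mulr_ge0, addr_ge0)// ltW.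
have F1 : d^-1 * d^-1 * F <= N%:R * d.
  rewrite -mulrA !ler_pdivrMl//; apply: le_trans Fd _.
  by rewrite le_eqVlt; apply/orP; left; apply/eqP; ring.
(* Here [d^-1 * F <= N * d ^+ 2 <= N * d], the last step because [d <= 1]. *)
have D1 : d^-1 * D0 <= C * (N%:R * d).
  rewrite ler_pdivrMl//; apply: le_trans D _; rewrite mulrCA ler_wpM2l//.
  apply: le_trans Fd _.
  rewrite exprS mulrCA ler_pM2l// ler_wpM2l// expr2 ler_piMr// ltW//.
have H' : beta / 2 * (q%:R * N%:R * d + d^-1 * D0)
    <= beta / 2 * (q%:R * N%:R * d + C * (N%:R * d)).
  by rewrite ler_wpM2l ?lerD2l// divr_ge0// ltW.
have Z' : 2 * beta * (q%:R * (N%:R * d + d^-1 * d^-1 * F))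
    <= 2 * beta * (q%:R * (N%:R * d + N%:R * d)).
  by rewrite ler_wpM2l ?mulr_ge0 ?(ltW beta0)// ler_wpM2l// lerD2l.
rewrite [leRHS](_ : _ = beta / 2 * (q%:R * N%:R * d + C * (N%:R * d))
   + N%:R * d * ln q%:R + 2 * beta * (q%:R * (N%:R * d + N%:R * d))); last by field.
lra.
Qed.

End Potts.

(** * The centered gradient at the conditional probabilities *)

Section Gradient.
Context {R : realType} {q N : nat} (A : 'M[R]_N) (beta : R) (B : 'rV[R]_q.-1).
Hypotheses (Asym : A^T = A) (Adiag : forall i, A i i = 0).
Local Notation th := (theta A beta B).

(* The part of the gradient at [theta] that is not proportional to the local
   field error does not depend on the spin, so it cancels after centering. *)
Lemma l2norm_centered_grad_le x r :
  l2norm (grad_psi A beta B r (th x) - mean_grad_psi A beta B (th x)) ^+ 2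
  <= beta ^+ 2 * \sum_i \sum_s (A *m (onehot x - th x)) i s ^+ 2.
Proof.
rewrite sqr_sqrtr; last by apply: sumr_ge0 => i _; exact: sqr_ge0.
rewrite mulr_sumr; apply: ler_sum => i _.
pose e s := (A *m (onehot x - th x)) i s.
(* The log-normalizer of the softmax, minus one: the spin-independent part of the gradient. *)
pose L := ln (\sum_s expR (beta * (A *m onehot x) i s + ext_field B s)) - 1.
have gE s : grad_psi A beta B s (th x) i ord0 = L - beta * e s.
  rewrite grad_psiE//; last exact: theta_gt0.
  rewrite [in X in _ - X]thetaE_softmax// ln_softmax /L /e.
  have -> : (A *m (onehot x - th x)) i s = (A *m onehot x) i s - (A *m th x) i s.
    by rewrite mulmxBr mxE [X in _ + X]mxE.
  rewrite [(A *m th x) i s]mxE; ring.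
have q0 : q%:R != 0 :> R by rewrite pnatr_eq0 -lt0n; case: r => r; case: (q).
have -> : (grad_psi A beta B r (th x) - mean_grad_psi A beta B (th x)) i ord0
    = - beta * (e r - q%:R^-1 * \sum_s e s).
  rewrite mxE [X in _ + X]mxE [X in _ - X]mxE summxE gE.
  under eq_bigr do rewrite gE.
  rewrite sumrB -mulr_sumr sumr_const card_ord -(mulr_natr L).
  by field.
rewrite exprMn sqrrN ler_wpM2l ?sqr_ge0//.
exact: sqr_center_le.
Qed.

End Gradient.

(** * Asymptotics *)

Section Asymptotics.
Context {R : realType} {q : nat} (hq : (2 <= q)%N).
Context (A : forall N : nat, 'M[R]_N) (beta : R) (B : 'rV[R]_q.-1).

Lemma potts_oP_near (Y : forall N, {ffun 'I_N -> 'I_q} -> R) (a : nat -> R) :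
  (forall eps eta : R, 0 < eps -> 0 < eta -> \forall N \near \oo,
    potts_Pr (A N) beta B (fun x => eps * a N < `|Y N x|) <= eta) ->
  potts_oP A beta B Y a.
Proof.
move=> h eps eps0; apply/cvgr0Pnorm_le => eta eta0.
near=> N; rewrite ger0_norm; first by near: N; exact: h.
apply: sumr_ge0 => x _.
by apply: potts_pmf_ge0; apply: leq_trans hq.
Unshelve. all: by end_near. Qed.

Lemma row_sum_bounded :
  (ereal_sup [set (\big[Num.max/0]_(i < N) \sum_(j < N) A N i j)%:E
             | N in [set N : nat | (1 <= N)%N]] < +oo)%E ->
  exists2 M : R, 0 <= M & forall N i, \sum_j A N i j <= M.
Proof.
set S := [set _ | _ in _].
(* The value [-oo] is excluded because the set contains the finite value at [N = 1]. *)
case E : (ereal_sup S) => [M| |] // _; last first.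
  suff : (\big[Num.max/0]_(i < 1) \sum_(j < 1) A 1%N i j)%:E = -oo%E :> \bar R by [].
  apply/eqP; rewrite -leeNy_eq -E; apply: ereal_sup_ubound.
  by exists 1%N.
have SM N : (0 < N)%N -> \big[Num.max/0]_(i < N) \sum_(j < N) A N i j <= M.
  by move=> N0; rewrite -lee_fin -E; apply: ereal_sup_ubound; exists N.
exists M => [|N i].
  by apply: le_trans (SM 1%N isT); rewrite bigmax_idl le_max lexx.
apply: le_trans (SM N _); last by case: i => i; case: (N).
exact: (le_bigmax _ (fun i => \sum_j A N i j)).
Qed.

End Asymptotics.

Theorem lemmaI6 (R : realType) (q : nat) (hq : (2 <= q)%N)
    (A : forall N : nat, 'M[R]_N) (beta : R) (B : 'rV[R]_q.-1)
    (hbeta : 0 < beta)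
    (hsym : forall N, (A N)^T = A N)
    (hdiag : forall N i, A N i i = 0)
    (hA0 : forall N i j, 0 <= A N i j)
    (hsup : (ereal_sup [set (\big[Num.max/0]_(i < N) \sum_(j < N) A N i j)%:E
                       | N in [set N : nat | (1 <= N)%N]] < +oo)%E)
    (hliminf : (0 < limn_einf (fun N =>
                  (N%:R^-1 * \sum_(i < N) \sum_(j < N) A N i j)%:E))%E)
    (hlim : (fun N => N%:R^-1 * \sum_(i < N) \sum_(j < N) A N i j ^+ 2) @ \oo
              --> (0 : R)) :
  potts_oP A beta B
    (fun N X => potts_psi (A N) beta B (theta (A N) beta B X)
                - sup [set potts_psi (A N) beta B y | y in simplex_prod R N q])
    (fun N => N%:R)
  /\
  forall r : 'I_q,
    potts_oP A beta B
      (fun N X => l2norm (grad_psi (A N) beta B r (theta (A N) beta B X)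
                          - mean_grad_psi (A N) beta B (theta (A N) beta B X)))
      (fun N => Num.sqrt N%:R).
Proof.
have [M M0 AM] := row_sum_bounded hsup.
have q0 : (0 < q)%N := ltnW hq.
have Fsmall (eta : R) : 0 < eta -> \forall N \near \oo,
    (0 < N)%N /\ \sum_(i < N) \sum_(j < N) A N i j ^+ 2 <= N%:R * eta.
  move=> eta0; have /cvgr0Pnorm_le/(_ _ eta0) h := hlim.
  near=> N.
  have N0 : (0 < N)%N by near: N; exact: nbhs_infty_gt.
  split=> //; rewrite -ler_pdivrMl ?ltr0n//.
  by apply: le_trans (ler_norm _) _; near: N; exact: h.
split=> [|r]; apply: (potts_oP_near hq) => eps eta eps0 eta0.
  pose C := beta / 2 * (q%:R + q%:R * (1 + 2 * beta * q%:R * M))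
            + ln q%:R + 4 * beta * q%:R.
  have C0 : 0 <= C.
    by rewrite /C !(mulr_ge0, addr_ge0, divr_ge0)// ?(ltW hbeta)// ln_ge0// ler1n.
  (* Markov at level [eps * N] requires a mean gap of at most [eta * eps * N], while the gap bound
     is [N * d * C]. Dividing by [C + 1] avoids a zero denominator. *)
  pose d := Num.min 1 (eta * eps / (C + 1)).
  have C1 : 0 < C + 1 by rewrite ltr_wpDl.
  have d0 : 0 < d by rewrite lt_min ltr01 divr_gt0 ?mulr_gt0.
  have d1 : d <= 1 by rewrite ge_min lexx.
  have dC : d * C <= eta * eps.
    apply: (@le_trans _ _ (d * (C + 1))); first by rewrite ler_pM2l// lerDl.
    by rewrite -ler_pdivlMr// ge_min lexx orbT.
  have := Fsmall _ (exprn_gt0 3 d0); apply: filterS => N [N0 FN].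
  set V := sup _; pose psith x := potts_psi (A N) beta B (theta (A N) beta B x).
  have lnZ_ub : ubound [set potts_psi (A N) beta B y | y in simplex_prod R N q]
      (ln (potts_Z (A N) beta B)).
    by move=> _ [y ys <-]; exact: potts_psi_le_ln_Z.
  have psi_V x : psith x <= V.
    apply: ub_le_sup; first by exists (ln (potts_Z (A N) beta B)).
    by exists (theta (A N) beta B x) => //; exact: theta_simplex.
  (* The supremum is over a non-empty set: [theta] at a constant configuration lies in the
     simplex. *)
  have V_lnZ : V <= ln (potts_Z (A N) beta B).
    apply: ge_sup => //; pose x : {ffun 'I_N -> 'I_q} := [ffun=> Ordinal q0].
    exists (psith x), (theta (A N) beta B x) => //.
    exact: theta_simplex.
  have eN : 0 < eps * N%:R by rewrite mulr_gt0// ltr0n.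
  have mu0 := @potts_pmf_ge0 R q N (A N) beta B q0.
  apply: le_trans (markov_wmean mu0 eN (fun x => normr_ge0 (psith x - V))) _.
  rewrite ler_pdivrMl//.
  rewrite (@eq_wmean _ _ _ _ (fun x => V - psith x)); last first.
    by move=> x; rewrite distrC ger0_norm ?subr_ge0.
  rewrite wmeanB wmean_cst ?sum_potts_pmf//.
  apply: le_trans (lerB V_lnZ (lexx _)) _.
  apply: le_trans (wmean_psi_gap_le B q0 (hsym N) (hdiag N) (hA0 N) hbeta
    (AM N) M0 d0 d1 FN) _.
  rewrite -/C -mulrA [leRHS](_ : _ = N%:R * (eta * eps)); last by ring.
  by rewrite ler_pM2l ?ltr0n.
pose C := beta ^+ 2 * (q%:R * (1 + 2 * beta * q%:R * M)).
have C0 : 0 <= C.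
  by rewrite /C !(mulr_ge0, addr_ge0, sqr_ge0)// ltW.
have C1 : 0 < C + 1 by rewrite ltr_wpDl.
have k0 : 0 < eps ^+ 2 * eta / (C + 1).
  by rewrite divr_gt0// mulr_gt0// exprn_gt0.
have := Fsmall _ k0; apply: filterS => N [N0 FN].
have mu0 := @potts_pmf_ge0 R q N (A N) beta B q0.
pose f x := beta ^+ 2 * \sum_i \sum_s
  ((A N) *m (onehot x - theta (A N) beta B x)) i s ^+ 2.
have a0 : 0 < eps ^+ 2 * N%:R by rewrite mulr_gt0 ?exprn_gt0 ?ltr0n.
have f0 x : 0 <= f x.
  rewrite mulr_ge0 ?sqr_ge0// sumr_ge0// => i _; rewrite sumr_ge0// => s _.
  exact: sqr_ge0.
(* Squaring the event reduces the norm to the field error [f], to which Markov applies at level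
   [eps ^+ 2 * N]. *)
apply: (@le_trans _ _ (\sum_(x | eps ^+ 2 * N%:R < f x) potts_pmf (A N) beta B x)).
  rewrite /potts_Pr big_mkcond [leRHS]big_mkcond; apply: ler_sum => x _ /=.
  case: ifPn => [lt1|_]; last by case: ifP.
  rewrite ifT//.
  apply: lt_le_trans (l2norm_centered_grad_le beta B (hsym N) (hdiag N) x r).
  rewrite -(@sqr_sqrtr _ N%:R) ?ler0n// -exprMn.
  rewrite ltr_pXn2r ?nnegrE ?mulr_ge0 ?sqrtr_ge0 ?(ltW eps0)//.
  by rewrite ger0_norm ?sqrtr_ge0 in lt1.
apply: le_trans (markov_wmean mu0 a0 f0) _.
rewrite ler_pdivrMl// wmeanZ.
have D := wmean_field_error_le B q0 (hsym N) (hdiag N) (hA0 N) hbeta (AM N).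
apply: le_trans (ler_wpM2l (sqr_ge0 beta) D) _.
rewrite mulrA -/C; apply: le_trans (ler_wpM2l C0 FN) _.
apply: (@le_trans _ _ ((C + 1) * (N%:R * (eps ^+ 2 * eta / (C + 1))))).
  by rewrite ler_wpM2r ?lerDl// mulr_ge0 ?ler0n// ltW.
rewrite le_eqVlt; apply/orP; left; apply/eqP; field.
by rewrite gt_eqF.
Unshelve. all: by end_near. Qed.
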